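(* Let $(\Omega,\mathcal F,\mu,\{\mathcal F_n\}_{n\ge 0})$ be a filtered probability space. There is a constant $C>0$ such that for all $f\in L^1(\mu)$ there is a simple sparse operator $\mathbb S=\mathbb S_{M,f}$ such that $$Mf\le C\cdot\mathbb S|f|\quad\text{a.e.}$$
   Context: Filtered probability space: $(\Omega,\mathcal F,\mu)$ is a complete probability space, $\{\mathcal F_n\}_{n\ge0}$ is an increasing sequence of sub-$\sigma$-algebras of $\mathcal F$, each $(\Omega,\mathcal F_n,\mu)$ is complete, and $\mathcal F$ is the $\sigma$-algebra generated by $\bigcup_n\mathcal F_n$. Doob's maximal operator: $Mf=\sup_{n\ge0}|f_n|$, where $f_n=\mathbb E(f\mid\mathcal F_n)$. Stopping times: $\tau:\Omega\to\{0,1,2,\dots\}\cup\{\infty\}$ with $\{\tau=n\}\in\mathcal F_n$ for all $n$; $\mathcal F_\tau=\{F\in\mathcal F: F\cap\{\tau\le n\}\in\mathcal F_n\ \forall n\}$. Local space induced by a stopping time $\tau$: if $\mu(\tau<\infty)>0$, it is $(\widetilde\Omega,\widetilde{\mathcal F},\widetilde\mu,\{\widetilde{\mathcal F}_n\})$ with $\widetilde\Omega=\{\tau<\infty\}$, $\widetilde{\mathcal F}=\mathcal F|_{\{\tau<\infty\}}$, $\widetilde{\mathcal F}_n=\mathcal F_{\tau+n}|_{\{\tau<\infty\}}$, $\widetilde\mu=\mu|_{\{\tau<\infty\}}/\mu(\tau<\infty)$; any stopping time on this local space is called a locally filter-shifted stopping time relative to $\tau$. If $\mu(\tau<\infty)=0$,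 the local space is the space on which $\tau$ is defined, and $\tau$ itself is the only locally filter-shifted stopping time relative to $\tau$. Conditional sparsity: let $(\Omega^{(0)},\mathcal F^{(0)},\mu^{(0)},\{\mathcal F^{(0)}_n\})=(\Omega,\mathcal F,\mu,\{\mathcal F_n\})$, $\tau^{(0)}=0$, and for $i\ge0$ let $(\Omega^{(i+1)},\mathcal F^{(i+1)},\mu^{(i+1)},\{\mathcal F^{(i+1)}_n\})$ be the local space induced by the stopping time $\tau^{(i)}$ of $(\Omega^{(i)},\mathcal F^{(i)},\mu^{(i)},\{\mathcal F^{(i)}_n\})$, and $\tau^{(i+1)}$ a locally filter-shifted stopping time relative to $\tau^{(i)}$. Put $E_i=\{\tau^{(i)}<\infty\}$ and $S_i=E_i\setminus E_{i+1}$. The sequence $\{\tau^{(i)}\}_{i\ge0}$ is conditionally sparse if there is a constant $K\ge1$ with $$\mathbf 1_{E_i}\le K\,\mathbb E\big(\mathbf 1_{S_i}\mid\mathcal F^{(i)}_{\tau^{(i)}}\big)\mathbf 1_{E_i}\qquad\text{for all } i\ge0 .$$ Conditional expectations given $\mathcal F^{(i)}_{\tau^{(i)}}$ are taken on $(\Omega^{(i)},\mathcal F^{(i)},\mu^{(i)})$, and their products with $\mathbf 1_{E_i}$ or $\mathbf 1_{S_i}$ are extended by $0$ to $\Omega$. Simple sparse operator: an operator of the form $\mathbb S|f|=\sum_{i=0}^\infty \mathbb E\big(|f|\mid\mathcal F^{(i)}_{\tau^{(i)}}\big)\mathbf 1_{S_i}$, $f\in L^1$, where $\{\tau^{(i)}\}_{i\ge0}$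 is conditionally sparse. *)

(* Defs.v *)
From HB Require Import structures.
From mathcomp Require Import all_boot all_order all_algebra.
From mathcomp Require Import all_classical all_reals all_analysis.

Set Implicit Arguments.
Unset Strict Implicit.
Unset Printing Implicit Defensive.

Import Order.TTheory GRing.Theory Num.Theory.
Import numFieldNormedType.Exports.

Local Open Scope classical_set_scope.
Local Open Scope ring_scope.

Record filtered_probability_space (d : measure_display) (T : measurableType d)
    (R : realType) (P : probability T R) (F : nat -> set (set T)) : Prop := {
  fps_complete : measure_is_complete P;
  fps_sigma : forall n, sigma_algebra [set: T] (F n);
  fps_sub : forall n, F n `<=` measurable;
  fps_incr : forall m n, (m <= n)%N -> F m `<=` F n;
  fps_complete_n : forall n A B, F n A -> P A = 0%E -> B `<=` A -> F n B;
  fps_gen : measurable = <<s \bigcup_n F n >> }.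

(* The data (dom, sets, mes, filt) of a filtered space whose underlying set is
   a subset of the fixed space T; sets and filt n are families of subsets of
   dom. The measure is a set function on the whole of T, concentrated on dom,
   so that integrals over members of sets are integrals of the library. *)
Record fspace (d : measure_display) (T : measurableType d) (R : realType) :=
  FSpace {
    fs_dom : set T;
    fs_sets : set (set T);
    fs_mes : set T -> \bar R;
    fs_filt : nat -> set (set T) }.

(* Random times are total on T, with None standing for the value infinity; only
   their values on fs_dom matter. *)
Definition rtime (T : Type) := T -> option nat.

Section local_spaces.
Context (d : measure_display) (T : measurableType d) (R : realType).
Implicit Types (X : fspace T R) (tau : rtime T) (G : set (set T)).

Definition rtime_le tau (n : nat) : set T :=
  [set x | if tau x is Some k then (k <= n)%N else false].

Definition rtime_shift tau (n : nat) : rtime T :=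
  fun x => omap (addn^~ n) (tau x).

Definition is_stopping_time X tau : Prop :=
  forall n, fs_filt X n (fs_dom X `&` [set x | tau x = Some n]).

Definition stopped_sigma X tau : set (set T) :=
  [set A | fs_sets X A /\ forall n, fs_filt X n (A `&` rtime_le tau n)].

Definition finite_part X tau : set T := fs_dom X `&` [set x | tau x <> None].

Definition trace (G : set (set T)) (E : set T) : set (set T) :=
  [set A `&` E | A in G].

Definition local_space X tau : fspace T R :=
  let E := finite_part X tau in
  if (0 < fs_mes X E)%E then
    FSpace E (trace (fs_sets X) E)
      (fun A => fs_mes X (A `&` E) * ((fine (fs_mes X E))^-1)%:E)%E
      (fun n => trace (stopped_sigma X (rtime_shift tau n)) E)
  else X.

Definition locally_shifted X tau tau' : Prop :=
  if (0 < fs_mes X (finite_part X tau))%E then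
    is_stopping_time (local_space X tau) tau'
  else forall x, fs_dom X x -> tau' x = tau x.

(* g is a version of E(f | G) on the space X. *)
Definition is_condexp X G (f g : T -> R) : Prop :=
  [/\ forall B : set R, measurable B -> G (fs_dom X `&` g @^-1` B),
      (fs_mes X).-integrable (fs_dom X) (EFin \o g)
    & forall A, G A ->
        (\int[fs_mes X]_(x in A) (g x)%:E = \int[fs_mes X]_(x in A) (f x)%:E)%E].

(* A chosen version of E(f | G); the default value 0 is irrelevant when f is
   integrable and G is a sub-sigma-algebra, since versions then exist. *)
Definition condexp X G (f : T -> R) : T -> R :=
  xget (cst 0) [set g | is_condexp X G f g].

Context (P : probability T R) (F : nat -> set (set T)).

Definition base_space : fspace T R := FSpace [set: T] measurable P F.

Definition doob_maximal (f : T -> R) (x : T) : \bar R :=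
  ereal_sup (range (fun n => `|condexp base_space (F n) f x|%:E)).

Section sequence.
Context (tau : nat -> rtime T).

Fixpoint iter_space (i : nat) : fspace T R :=
  if i is j.+1 then local_space (iter_space j) (tau j) else base_space.

Definition sparse_E (i : nat) : set T := finite_part (iter_space i) (tau i).

Definition sparse_S (i : nat) : set T := sparse_E i `\` sparse_E i.+1.

Definition sparse_condexp (i : nat) (f : T -> R) : T -> R :=
  condexp (iter_space i) (stopped_sigma (iter_space i) (tau i)) f.

Definition conditionally_sparse : Prop :=
  [/\ forall x, tau 0%N x = Some 0%N,
      forall i, locally_shifted (iter_space i) (tau i) (tau i.+1)
    & exists2 K : R, 1 <= K & forall i, {ae P, forall x,
        \1_(sparse_E i) x
          <= K * sparse_condexp i \1_(sparse_S i) x * \1_(sparse_E i) x}].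

Definition sparse_sum (f : T -> R) (x : T) : \bar R :=
  (\sum_(0 <= i <oo) (sparse_condexp i f x * \1_(sparse_S i) x)%:E)%E.

End sequence.

(* Sop is to be applied to absolute values of integrable functions. *)
Definition simple_sparse_operator (Sop : (T -> R) -> T -> \bar R) : Prop :=
  exists tau : nat -> rtime T, conditionally_sparse tau /\ Sop = sparse_sum tau.

End local_spaces.

(* Main.v *)
Require Import Defs.
From HB Require Import structures.
From mathcomp Require Import all_boot all_order all_algebra.
From mathcomp Require Import all_classical all_reals all_analysis.
From mathcomp Require Import measurable_realfun.
From mathcomp Require Import zify lra.

(** Let phi_n >= 0 be a version of E(|f| | F_n). Starting from time 0, stop
    again as soon as phi exceeds 4 times its value at the previous stopping
    time sigma_i. On the set S_i where sigma_i is the last finite time, every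
    phi_n is at most 4 phi_(sigma_i), and phi_(sigma_i) is the conditional
    expectation of |f| appearing in the i-th term of the sparse operator.
    Sparsity: if B is in F_m and lies in {sigma_i = m, a <= phi_m <= 2a}, then
    4a P(B, sigma_(i+1) < oo) <= int_B |f| = int_B phi_m <= 2a P(B). Hence half
    of the mass of E_i lies in S_i, conditionally on F_(sigma_i), and the S_i
    cover the space up to a null set.
    The times tau_i of the local spaces are the increments of the sigma_i: the
    i-th local filtration at time n consists of the sets A with
    A n {sigma_(i-1) = k} in F_(k+n) for all k. *)

Import Order.TTheory GRing.Theory Num.Theory.
Import numFieldNormedType.Exports.

Set Implicit Arguments.
Unset Strict Implicit.
Unset Printing Implicit Defensive.

Local Open Scope classical_set_scope.
Local Open Scope ring_scope.

(** * Existence of conditional expectations *)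

Section indefinite_integral.
Context (d : measure_display) (T : measurableType d) (R : realType).
Context (P : probability T R) (G : set (set T)).
Hypothesis GM : <<s G >> `<=` measurable.

(** [P] carried over to the coarse measurable space generated by [G], so that a density with respect
    to it is automatically [G]-measurable. *)
Definition restricted_measure : set (g_sigma_algebraType G) -> \bar R :=
  pushforward P (id : T -> g_sigma_algebraType G).

Let r0 : restricted_measure set0 = 0%E.
Proof. by rewrite /restricted_measure /pushforward preimage_set0 measure0. Qed.

Let r_ge0 A : (0 <= restricted_measure A)%E.
Proof. by rewrite /restricted_measure /pushforward measure_ge0. Qed.

Let r_add : semi_sigma_additive restricted_measure.
Proof.
move=> A mA tA mUA; apply: measure_semi_sigma_additive => //.
by move=> _ Y mY; rewrite setTI; exact: GM.
Qed.

HB.instance Definition _ :=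
  isMeasure.Build _ _ _ restricted_measure r0 r_ge0 r_add.

Let r_fin : fin_num_fun restricted_measure.
Proof. by move=> A mA; apply: fin_num_measure; exact: GM. Qed.

HB.instance Definition _ := @Measure_isFinite.Build _ _ _ restricted_measure r_fin.

Context (h : T -> R).
Hypothesis h0 : forall x, 0 <= h x.
Hypothesis ih : P.-integrable setT (EFin \o h).

Definition indefinite_integral (A : set (g_sigma_algebraType G)) : \bar R :=
  (\int[P]_(x in (A : set T)) (h x)%:E)%E.

Let m0 : indefinite_integral set0 = 0%E.
Proof. exact: integral_set0. Qed.

Let m_ge0 A : (0 <= indefinite_integral A)%E.
Proof. by apply: integral_ge0 => x _; rewrite lee_fin. Qed.

Let m_add : semi_sigma_additive indefinite_integral.
Proof.
move=> A mA tA mUA.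
have mA' i : measurable (A i : set T) by exact: GM (mA i).
have mh := measurable_int _ ih.
rewrite /indefinite_integral ge0_integral_bigcup//=.
- apply: is_cvg_ereal_nneg_natsum => n _.
  by apply: integral_ge0 => x _; rewrite lee_fin.
- exact: (measurable_funS measurableT _ mh).
- by move=> x _; rewrite lee_fin.
Qed.

HB.instance Definition _ := isMeasure.Build _ _ _ indefinite_integral m0 m_ge0 m_add.

Let m_fin : fin_num_fun indefinite_integral.
Proof.
move=> A mA; rewrite /indefinite_integral; apply: integrable_fin_num.
  exact: GM.
by apply: integrableS ih => //; exact: GM.
Qed.

HB.instance Definition _ := @Measure_isFinite.Build _ _ _ indefinite_integral m_fin.

(** Radon-Nikodym: the version is the density of [indefinite_integral] with respect to
    [restricted_measure]. It is nonnegative at every point, not just almost everywhere. *)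
Lemma condexp_exists : sigma_algebra setT G ->
  exists g : T -> R, [/\ forall x, 0 <= g x,
    forall B : set R, measurable B -> G (g @^-1` B),
    P.-integrable setT (EFin \o g)
    & forall A, G A ->
        (\int[P]_(x in A) (g x)%:E = \int[P]_(x in A) (h x)%:E)%E].
Proof.
move=> sG; have mGE : <<s G >> = G by exact: sigma_algebra_id.
have mh := measurable_int _ ih.
have mid : measurable_fun setT (id : T -> g_sigma_algebraType G).
  by move=> _ A mA; rewrite setTI; exact: GM.
have dom : indefinite_integral `<< restricted_measure.
  apply/null_content_dominatesP => A mA PA0; apply: null_set_integral => //.
  - exact: GM.
  - exact: (measurable_funS measurableT _ mh).
have [g [g0 gfin ig gE]] := radon_nikodym_sigma_finite dom.
have gfineK : EFin \o (fine \o g) = g by apply/funext => x /=; rewrite fineK.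
have mg := measurable_int _ ig.
have mfg : measurable_fun setT (fine \o g).
  by apply/measurable_EFinP; rewrite gfineK.
(* For coarsely measurable integrands, integrals against the restriction and against [P] agree; this
   brings integrability and the defining identity back to [P]. *)
have intE (k : g_sigma_algebraType G -> \bar R) A : <<s G >> A ->
    measurable_fun setT k -> (forall x, 0 <= k x)%E ->
    (\int[restricted_measure]_(x in A) k x = \int[P]_(x in A) k x)%E.
  move=> mA mk k0; rewrite /restricted_measure ge0_integral_pushforward//.
  exact: (measurable_funS measurableT _ mk).
exists (fine \o g); split.
- by move=> x; rewrite fine_ge0.
- move=> B mB; rewrite -[X in X _]mGE.
  by rewrite -[X in <<s _ >> X]setTI; exact: mfg.
- rewrite gfineK; apply/integrableP; split.
    by move=> _ A mA; apply: GM; exact: mg.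
  move/integrableP: ig => [_].
  rewrite (intE (abse \o g))//; first exact: (@measurableT _ (g_sigma_algebraType G)).
    exact: measurableT_comp.
  by move=> x /=.
- move=> A GA; rewrite -mGE in GA; under eq_integral => x _ do rewrite /= fineK//.
  by rewrite -(intE g)//; exact/esym/gE.
Qed.

End indefinite_integral.

(** * Almost everywhere comparison *)

Section comparison.
Context (d : measure_display) (T : measurableType d) (R : realType).
Context (P : probability T R).

Lemma ae_forall_rat (Q : rat -> T -> Prop) :
  (forall q, {ae P, forall x, Q q x}) -> {ae P, forall x q, Q q x}.
Proof.
move=> H.
have : {ae P, forall x (n : nat), if unpickle n is Some q then Q q x else True}.
  by apply/ae_foralln => n; case: unpickle => [q|]; [exact: H|exact: aeW].
by apply: filterS => x Hx q; have := Hx (pickle q); rewrite pickleK.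
Qed.

Lemma measure0_integral_le0 (A : set T) (k : T -> R) : measurable A ->
  measurable_fun A (EFin \o k) -> (forall x, A x -> 0 < k x) ->
  (\int[P]_(x in A) (k x)%:E <= 0)%E -> P A = 0%E.
Proof.
move=> mA mk k0 ik.
have : (\int[P]_(x in A) `|(k x)%:E| = 0)%E.
  apply/eqP; rewrite eq_le integral_ge0// andbT; apply: le_trans ik.
  rewrite le_eqVlt; apply/orP; left; apply/eqP; apply: eq_integral => x.
  by rewrite inE => Ax; rewrite gee0_abs// lee_fin ltW// k0.
move/(ae_eq_integral_abs P mA mk) => h; apply/(negligibleP _ mA).
case: h => N [mN N0 hN]; exists N; split => // x Ax; apply: hN => /= /(_ Ax) [] kx0.
by have := k0 x Ax; rewrite kx0 ltxx.
Qed.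

(** The set where [g2 < g1] is the countable union of the slices [g2 < q < g1] with [q] rational,
    and the hypothesis makes the integral of [g1 - g2 > 0] over each slice nonpositive, so each is
    null. A slice involves only level sets of the two functions separately, which makes its
    membership in a given sigma-algebra easy to check. *)
Lemma ae_le_integral_slices (D : set T) (g1 g2 : T -> R) : measurable D ->
  P.-integrable D (EFin \o g1) -> P.-integrable D (EFin \o g2) ->
  (forall (q : R) A, A = D `&` [set x | q < g1 x] `&` [set x | g2 x < q] ->
     (\int[P]_(x in A) (g1 x)%:E <= \int[P]_(x in A) (g2 x)%:E)%E) ->
  {ae P, forall x, D x -> g1 x <= g2 x}.
Proof.
move=> mD i1 i2 H.
have m1 : measurable_fun D g1 by apply/measurable_EFinP; exact: measurable_int i1.
have m2 : measurable_fun D g2 by apply/measurable_EFinP; exact: measurable_int i2.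
pose A (q : rat) := D `&` [set x | ratr q < g1 x] `&` [set x | g2 x < ratr q].
have AE q : A q = (D `&` g1 @^-1` `]ratr q, +oo[) `&` (D `&` g2 @^-1` `]-oo, ratr q[).
  by rewrite setIACA setIid setIA; apply/seteqP; split => x /=; rewrite !in_itv/= ?andbT.
have mA q : measurable (A q).
  by rewrite AE; apply: measurableI; [exact: m1|exact: m2].
have AD q : A q `<=` D by move=> x [[]].
have PA0 q : P (A q) = 0%E.
  have iA1 := integrableS mD (mA q) (AD q) i1.
  have iA2 := integrableS mD (mA q) (AD q) i2.
  apply: (@measure0_integral_le0 _ (g1 \- g2)) => //.
  - exact: measurable_int (integrableB (mA q) iA1 iA2).
  - by move=> x [[_ /= qx] xq]; rewrite subr_gt0 (lt_trans xq).
  - have := integralB (mA q) iA1 iA2; rewrite /= => ->.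
    rewrite leeBlDr; first by rewrite add0e; exact: (H (ratr q)).
    exact: integrable_fin_num.
have : {ae P, forall x q, ~ A q x}.
  by apply: ae_forall_rat => q; exists (A q); split => // x /= /contrapT.
apply: filterS => x Hx Dx; rewrite leNgt; apply/negP => /rat_in_itvoo[q].
by rewrite in_itv/= => /andP[g2q qg1]; exact: (Hx q).
Qed.

End comparison.

(** * Local spaces as shifted filtrations *)

Section sigma_algebra_closure.
Context (T : pointedType) (G : set (set T)).
Hypothesis sG : sigma_algebra setT G.

Let gE : (measurable : set (set (g_sigma_algebraType G))) = G.
Proof. exact: measurable_g_measurableTypeE. Qed.

Lemma sigma_setT : G setT.
Proof. by rewrite -gE; exact: measurableT. Qed.

Lemma sigma_setI A B : G A -> G B -> G (A `&` B).
Proof. by rewrite -gE; exact: measurableI. Qed.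

Lemma sigma_setC A : G A -> G (~` A).
Proof. by rewrite -gE; exact: measurableC. Qed.

Lemma sigma_bigcup (A : nat -> set T) : (forall n, G (A n)) -> G (\bigcup_n A n).
Proof. by case: sG => _ _; apply. Qed.

Lemma sigma_bigcap (A : nat -> set T) : (forall n, G (A n)) -> G (\bigcap_n A n).
Proof. by rewrite -gE => h; exact: bigcapT_measurable. Qed.

Lemma sigma_lt (R : realType) (f g : T -> R) :
  (forall B, measurable B -> G (f @^-1` B)) ->
  (forall B, measurable B -> G (g @^-1` B)) -> G [set x | f x < g x].
Proof.
move=> mf mg.
have m h : (forall B, measurable B -> G (h @^-1` B)) ->
    measurable_fun setT (h : g_sigma_algebraType G -> R).
  by move=> mh _ B mB; rewrite setTI gE; exact: mh.
have := measurable_fun_ltr (m _ mf) (m _ mg) measurableT.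
by move=> /(_ [set true]); rewrite setTI gE; apply.
Qed.

End sigma_algebra_closure.

(** If a local space starts at time [s] of the original clock and [t] is a time on its own clock,
    this is [t] read on the original clock. *)
Definition rtime_add (T : Type) (s t : rtime T) : rtime T :=
  fun x => if s x is Some k then omap (addn k) (t x) else None.

Definition rtime_at (T : Type) (s : rtime T) (k : nat) : set T :=
  [set x | s x = Some k].

Section shifted_spaces.
Context (d : measure_display) (T : measurableType d) (R : realType).
Context (P : probability T R) (F : nat -> set (set T)).
Hypothesis hF : filtered_probability_space P F.
Implicit Types (X : fspace T R) (s t : rtime T).

Let sF n := fps_sigma hF n.

Lemma filtration_le m n A : (m <= n)%N -> F m A -> F n A.
Proof. by move=> mn; exact: (fps_incr hF mn). Qed.

Lemma filtration_measurable n A : F n A -> measurable A.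
Proof. exact: (fps_sub hF). Qed.

(** Invariant of the iterated local spaces: [X] is the original space restarted at the stopping time
    [s]. It replaces nested traces of stopped sigma-algebras by conditions on the original
    filtration; the successive normalisations are absorbed in [c]. *)
Record shifted_space X s : Prop := {
  shifted_dom : fs_dom X = [set x | s x <> None];
  shifted_stop : forall k, F k (rtime_at s k);
  shifted_sets : forall A, fs_sets X A <-> measurable A /\ A `<=` fs_dom X;
  shifted_filt : forall n A, fs_filt X n A <->
    A `<=` fs_dom X /\ forall k, F (k + n)%N (A `&` rtime_at s k);
  shifted_mes : exists2 c : R, 0 < c &
    fs_mes X = (fun A => c%:E * P (A `&` fs_dom X))%E }.

Lemma rtime_atE s : [set x | s x <> None] = \bigcup_k rtime_at s k.
Proof.
apply/seteqP; split => [x /=|x [k _]]; last by rewrite /rtime_at /= => ->.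
by case E: (s x) => [k|]// _; exists k.
Qed.

Lemma rtime_at_addP s t m x :
  rtime_at (rtime_add s t) m x <->
  exists a b, [/\ (a + b)%N = m, rtime_at s a x & rtime_at t b x].
Proof.
rewrite /rtime_at /rtime_add /=; split; last by move=> [a [b [<- -> ->]]].
by case: (s x) => // a; case: (t x) => //= b [<-]; exists a, b.
Qed.

Lemma filtration_at2 {X s t} : shifted_space X s -> is_stopping_time X t ->
  forall a b, F (a + b)%N (rtime_at s a `&` rtime_at t b).
Proof.
move=> hX ht a b; have /(shifted_filt hX)[_ /(_ a)] := ht b.
congr (F _ _); rewrite (shifted_dom hX); apply/seteqP; split => x.
  by move=> [[_ tb] sa].
by move=> [sa tb]; split => //; split => //; rewrite /= sa.
Qed.

(** Two nested stoppings collapse into one at [rtime_add s t]: the event that this sum equals [m] is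
    the countable union of the events [s = a], [t = b] with [a + b = m]. *)
Lemma stopped_sigma_shiftP X s t n A : shifted_space X s ->
  is_stopping_time X t ->
  stopped_sigma X (rtime_shift t n) A <->
  [/\ measurable A, A `<=` fs_dom X
    & forall m, F (m + n)%N (A `&` rtime_at (rtime_add s t) m)].
Proof.
move=> hX ht; have st := filtration_at2 hX ht; split.
- move=> [/(shifted_sets hX)[mA AX] h]; split => // m.
  have -> : A `&` rtime_at (rtime_add s t) m = \bigcup_a \bigcup_b
      if (a + b == m)%N then A `&` (rtime_at s a `&` rtime_at t b) else set0.
    apply/seteqP; split.
      move=> x [Ax /rtime_at_addP[a [b [abm sa tb]]]].
      by exists a => //; exists b => //; rewrite abm eqxx.
    move=> x [a _] [b _]; case: eqP => // abm [Ax [sa tb]]; split => //.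
    by apply/rtime_at_addP; exists a, b.
  apply: sigma_bigcup => // a; apply: sigma_bigcup => // b.
  case: eqP => [abm|_]; last by case: (sF (m + n)%N).
  (* Local time [b + n] is the first at which [t + n] is known to have occurred when [t = b]; on
     [s = a] it is the original time [m + n]. *)
  have /(shifted_filt hX)[_ /(_ a)] := h (b + n)%N.
  rewrite addnA abm => h1.
  have h2 : F (m + n)%N (rtime_at s a `&` rtime_at t b).
    by apply: filtration_le (st a b); rewrite abm leq_addr.
  have := sigma_setI (sF _) h1 h2; congr (F _ _); apply/seteqP; split => x.
    by move=> [[[Ax _] _]].
  move=> [Ax [sa tb]]; split => //; split => //; split => //.
  by rewrite /rtime_le /rtime_shift /= tb /=.
- move=> [mA AX h]; split; first exact/(shifted_sets hX).
  move=> k; apply/(shifted_filt hX); split => [x [/AX]//|a].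
  have -> : A `&` rtime_le (rtime_shift t n) k `&` rtime_at s a = \bigcup_b
      if (b + n <= k)%N then A `&` rtime_at (rtime_add s t) (a + b) `&`
        (rtime_at s a `&` rtime_at t b) else set0.
    apply/seteqP; split.
      move=> x [[Ax]]; rewrite /rtime_le /rtime_shift /=.
      case E : (t x) => [b|]//= bnk sa; exists b => //; rewrite bnk.
      by split => //; split => //; apply/rtime_at_addP; exists a, b.
    move=> x [b _]; case: ifPn => // bnk [[Ax _] [sa tb]]; split => //; split => //.
    by rewrite /rtime_le /rtime_shift /= tb /=.
  apply: sigma_bigcup => // b; case: ifPn => [bnk|_]; last by case: (sF (a + k)%N).
  apply: sigma_setI => //.
    by apply: filtration_le (h (a + b)%N); lia.
  by apply: filtration_le (st a b); lia.
Qed.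

Lemma stopped_sigmaP X s t A : shifted_space X s -> is_stopping_time X t ->
  stopped_sigma X t A <-> [/\ measurable A, A `<=` fs_dom X
    & forall m, F m (A `&` rtime_at (rtime_add s t) m)].
Proof.
move=> hX ht; have := stopped_sigma_shiftP 0 A hX ht.
have -> : rtime_shift t 0 = t.
  by apply/funext => x; rewrite /rtime_shift; case: (t x) => //= k; rewrite addn0.
by move=> ->; split => -[mA AX h]; split => // m; have := h m; rewrite addn0.
Qed.

Lemma finite_part_add X s t : shifted_space X s ->
  finite_part X t = [set x | rtime_add s t x <> None].
Proof.
move=> hX; rewrite /finite_part (shifted_dom hX) /rtime_add.
apply/seteqP; split => x /=; case: (s x) => [k|]; case: (t x) => [b|] //=;
  intuition congruence.
Qed.

Lemma rtime_add_stop X s t : shifted_space X s -> is_stopping_time X t ->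
  forall k, F k (rtime_at (rtime_add s t) k).
Proof.
move=> hX ht k.
have -> : rtime_at (rtime_add s t) k = \bigcup_a \bigcup_b
    if (a + b == k)%N then rtime_at s a `&` rtime_at t b else set0.
  apply/seteqP; split.
    move=> x /rtime_at_addP[a [b [abm sa tb]]].
    by exists a => //; exists b => //; rewrite abm eqxx.
  move=> x [a _] [b _]; case: eqP => // abm [sa tb].
  by apply/rtime_at_addP; exists a, b.
apply: sigma_bigcup => // a; apply: sigma_bigcup => // b.
case: eqP => [<-|_]; first exact: (filtration_at2 hX).
by case: (sF k).
Qed.

Lemma rtime_measurable s : (forall k, F k (rtime_at s k)) ->
  measurable [set x | s x <> None].
Proof.
move=> hs; rewrite rtime_atE; apply: bigcup_measurable => k _.
exact: filtration_measurable (hs k).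
Qed.

Lemma shifted_dom_measurable X s : shifted_space X s -> measurable (fs_dom X).
Proof.
by move=> hX; rewrite (shifted_dom hX); exact: rtime_measurable (shifted_stop hX).
Qed.

(** Lets the case distinctions in [local_space] and [locally_shifted] be decided by [P] alone. *)
Lemma mes_gt0 X s t : shifted_space X s ->
  (0 < fs_mes X (finite_part X t))%E = (0 < P (finite_part X t))%E.
Proof.
move=> hX; have [c c0 ->] := shifted_mes hX.
by rewrite setIidl ?pmule_rgt0//; move=> x [].
Qed.

(** Induction step of the invariant: the starting time advances from [s] to [rtime_add s t]. *)
Lemma local_space_shifted X s t : shifted_space X s -> is_stopping_time X t ->
  (0 < P (finite_part X t))%E ->
  shifted_space (local_space X t) (rtime_add s t).
Proof.
move=> hX ht PE; have mE : measurable (finite_part X t).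
  by rewrite (finite_part_add _ hX); exact/rtime_measurable/(rtime_add_stop hX ht).
have EX : finite_part X t `<=` fs_dom X by move=> x [].
rewrite /local_space (mes_gt0 _ hX) PE; split => //=.
- exact: finite_part_add.
- exact: (rtime_add_stop hX ht).
- move=> A; split.
    move=> [B /(shifted_sets hX)[mB BX] <-]; split; first exact: measurableI.
    by move=> x [].
  move=> [mA AE]; exists A; last exact: setIidl.
  by apply/(shifted_sets hX); split => // x /AE/EX.
- move=> n A; split.
    move=> [B /(stopped_sigma_shiftP _ _ hX ht)[mB BX hB] <-]; split => [x []//|k].
    have := hB k; congr (F _ _).
    rewrite -setIA; congr setI; apply/esym/setIidr.
    by rewrite (finite_part_add _ hX) rtime_atE; exact: bigcup_sup.
  move=> [AE hA]; exists A; last exact: setIidl.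
  apply/(stopped_sigma_shiftP _ _ hX ht); split => //; last by move=> x /AE/EX.
  (* Measurability of [A] is recovered from its countably many pieces, the [k]-th lying in
     [F (k + n)]. *)
  rewrite -(setIidl AE) (finite_part_add _ hX) rtime_atE setI_bigcupr.
  by apply: bigcup_measurable => k _; exact: filtration_measurable (hA k).
- have [c c0 hc] := shifted_mes hX.
  have fE : P (finite_part X t) \is a fin_num by exact: fin_num_measure.
  (* The old factor divided by the old mass of the new domain. *)
  exists (c * (c * fine (P (finite_part X t)))^-1).
    by rewrite mulr_gt0// invr_gt0 mulr_gt0// fine_gt0// PE ltey_eq fE.
  apply/funext => A; rewrite hc (setIidl EX).
  have -> : A `&` finite_part X t `&` fs_dom X = A `&` finite_part X t.
    by apply: setIidl => x [_ /EX].
  by rewrite fineM//= muleAC -EFinM.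
Qed.

Lemma base_space_shifted : shifted_space (base_space P F) (fun=> Some 0%N).
Proof.
split => //=.
- by apply/seteqP; split.
- move=> k; rewrite /rtime_at /=; have [->|k0] := eqVneq k 0%N.
    by have := sigma_setT (sF 0%N); congr (F _ _); apply/seteqP; split.
  have -> : [set x : T | Some 0%N = Some k] = set0; last by case: (sF k).
  by apply/seteqP; split => x //= -[]; apply/eqP; rewrite eq_sym.
- by move=> A; split => [mA|[]//]; split.
- move=> n A; split.
    move=> FA; split => // k; rewrite /rtime_at /=; apply: sigma_setI => //.
      by apply: filtration_le FA; lia.
    have [->|k0] := eqVneq k 0%N.
      have := sigma_setT (sF (0 + n)%N); congr (F _ _); apply/seteqP; split => //.
    have -> : [set x : T | Some 0%N = Some k] = set0; last by case: (sF (k + n)%N).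
    by apply/seteqP; split => x //= -[]; apply/eqP; rewrite eq_sym.
  move=> [_ /(_ 0%N)]; rewrite add0n; congr (F _ _).
  by apply/setIidl => x.
- by exists 1 => //; apply/funext => A; rewrite mul1e setIT.
Qed.

End shifted_spaces.

(** * Conditional expectations on local spaces *)

Section shifted_condexp.
Context (d : measure_display) (T : measurableType d) (R : realType).
Context (P : probability T R) (F : nat -> set (set T)).
Hypothesis hF : filtered_probability_space P F.
Implicit Types (X : fspace T R) (s t : rtime T).

(** [fs_mes X] is a bare set function; identifying it with a scaled restriction of [P], which is a
    measure, opens it to the theory of integration. *)
Lemma ge0_integral_shifted X s : shifted_space P F X s ->
  exists2 c : R, 0 < c & exists2 nu : {measure set T -> \bar R},
    fs_mes X = nu & forall A (f : T -> \bar R), measurable A ->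
    A `<=` fs_dom X -> measurable_fun A f -> (forall x, A x -> 0 <= f x)%E ->
    (\int[nu]_(x in A) f x = c%:E * \int[P]_(x in A) f x)%E.
Proof.
move=> hX; have [c c0 hc] := shifted_mes hX; exists c => //.
have mD := shifted_dom_measurable hF hX.
pose k := NngNum (ltW c0).
exists (mscale k (mrestr P mD)); first by rewrite hc; exact/funext.
move=> A f mA AX mf f0.
rewrite (eq_measure_integral (mscale k P)); first exact: ge0_integral_mscale.
move=> B mB BA; transitivity (k%:num%:E * P (B `&` fs_dom X))%E => //.
by rewrite setIidl// => x /BA/AX.
Qed.

Lemma integral_shifted X s : shifted_space P F X s ->
  exists2 c : R, 0 < c &
    (forall f : T -> \bar R, (fs_mes X).-integrable (fs_dom X) f <->
                            P.-integrable (fs_dom X) f) /\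
    forall A (f : T -> \bar R), measurable A -> A `<=` fs_dom X ->
    P.-integrable (fs_dom X) f ->
    (\int[fs_mes X]_(x in A) f x = c%:E * \int[P]_(x in A) f x)%E.
Proof.
move=> hX; have [c c0 [nu -> hc]] := ge0_integral_shifted hX; exists c => //.
have mD := shifted_dom_measurable hF hX.
split.
  move=> f; split => /integrableP[mf fi]; apply/integrableP; split => //; move: fi.
    rewrite hc//; last exact: measurableT_comp.
    move=> ci; rewrite ltey; apply/eqP => e.
    by move: ci; rewrite e mulry gtr0_sg// mul1e ltxx.
  rewrite hc//; last exact: measurableT_comp.
  move=> fi; rewrite lte_mul_pinfty ?lee_fin ?ltW//.
move=> A f mA AX fi; have iA := integrableS mD mA AX fi.
have mf := measurable_int _ iA.
rewrite [LHS]integralE [X in _ = (_ * X)%E]integralE hc//; last exact: measurable_funepos.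
rewrite hc//; last exact: measurable_funeneg.
rewrite [RHS]muleBr//; apply: fin_num_adde_defl; rewrite fin_numN.
exact: integrable_neg_fin_num.
Qed.

(* A sigma-algebra on all of T whose trace on [fs_dom X] is the stopped
   sigma-algebra of a local space X. *)
Definition time_sigma s : set (set T) :=
  [set A | measurable A /\ forall m, F m (A `&` rtime_at s m)].

Lemma time_sigma_algebra s : (forall k, F k (rtime_at s k)) ->
  sigma_algebra setT (time_sigma s).
Proof.
move=> hs; split.
- by split => // m; rewrite set0I; case: (fps_sigma hF m).
- move=> A [mA hA]; split; first exact: measurableD.
  move=> m; have -> : ([set: T] `\` A) `&` rtime_at s m =
      ~` (A `&` rtime_at s m) `&` rtime_at s m.
    apply/seteqP; split => x /=.
      by move=> [[_ nA] sm]; split => // -[].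
    by move=> [nA sm]; split => //; split => // Ax; exact: nA.
  by apply: (sigma_setI (fps_sigma hF m)) => //; exact: (sigma_setC (fps_sigma hF m)).
- move=> A hA; split; first by apply: bigcup_measurable => k _; case: (hA k).
  move=> m; rewrite setI_bigcupl; apply: (sigma_bigcup (fps_sigma hF m)) => k.
  by case: (hA k).
Qed.

(** Frees the chosen version from the normalised measure: a version exists, so [condexp] has its
    defining properties, and the factor [c] cancels from both integrals. *)
Lemma condexp_shifted X s t (h : T -> R) : shifted_space P F X s ->
  is_stopping_time X t -> (forall x, 0 <= h x) ->
  P.-integrable setT (EFin \o h) ->
  let G := stopped_sigma X t in let g := condexp X G h in
  [/\ forall B : set R, measurable B -> G (fs_dom X `&` g @^-1` B),
      P.-integrable (fs_dom X) (EFin \o g)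
    & forall A, G A ->
        (\int[P]_(x in A) (g x)%:E = \int[P]_(x in A) (h x)%:E)%E].
Proof.
move=> hX ht h0 ih G g.
have mD := shifted_dom_measurable hF hX.
have [c c0 [hi hc]] := integral_shifted hX.
have GP := stopped_sigmaP hF _ hX ht.
have ihD : P.-integrable (fs_dom X) (EFin \o h) by exact: integrableS ih.
have sG := time_sigma_algebra (rtime_add_stop hF hX ht).
have [g0 [g0_ge0 mg0 ig0 g0E]] : exists g : T -> R, [/\ forall x, 0 <= g x,
    forall B : set R, measurable B -> time_sigma (rtime_add s t) (g @^-1` B),
    P.-integrable setT (EFin \o g)
    & forall A, time_sigma (rtime_add s t) A ->
        (\int[P]_(x in A) (g x)%:E = \int[P]_(x in A) (h x)%:E)%E].
  apply: condexp_exists => //; rewrite sigma_algebra_id//.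
  by move=> A [].
(* The global version [g0] for [time_sigma] is a version on [X] too, so the chosen value is not the
   default one. *)
have : is_condexp X G h g.
  apply: (@xgetPex _ (cst 0) [set g | is_condexp X G h g]); exists g0; split.
  - move=> B mB; apply/GP; have [mB1 mB2] := mg0 B mB; split => //.
      exact: measurableI.
    move=> m; have := mB2 m; congr (F _ _); apply/seteqP; split => x.
      move=> [gB sm]; split => //; split => //.
      rewrite (shifted_dom hX); move: sm; rewrite /rtime_at /rtime_add /=.
      by case: (s x).
    by move=> [[_ gB] sm].
  - by apply/hi; exact: integrableS ig0.
  - move=> A /GP[mA AX hA]; rewrite !(hc A)//; last exact: integrableS ig0.
    by congr (_ * _)%E; apply: g0E; split.
move=> [gG /hi ig gE]; split => // A GA; have /GP[mA AX hA] := GA.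
have cK y : ((c^-1)%:E * (c%:E * y) = y)%E.
  by rewrite muleA -EFinM mulVf ?gt_eqF// mul1e.
by have := gE A GA; rewrite !(hc A)// => e; rewrite -[LHS]cK e cK.
Qed.

End shifted_condexp.

(** * Principal stopping times *)

Section principal_times.
Context (d : measure_display) (T : measurableType d) (R : realType).
Context (P : probability T R) (F : nat -> set (set T)).
Hypothesis hF : filtered_probability_space P F.
Context (h : T -> R).
Hypothesis h_ge0 : forall x, 0 <= h x.
Hypothesis ih : P.-integrable setT (EFin \o h).
Context (phi : nat -> T -> R).
Hypothesis phi_ge0 : forall n x, 0 <= phi n x.
Hypothesis phi_filt : forall n (B : set R), measurable B -> F n (phi n @^-1` B).
Hypothesis iphi : forall n, P.-integrable setT (EFin \o phi n).
Hypothesis phiE : forall n A, F n A ->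
  (\int[P]_(x in A) (phi n x)%:E = \int[P]_(x in A) (h x)%:E)%E.
Implicit Types (X : fspace T R) (s t : rtime T).

Let sF n := fps_sigma hF n.
Let mF := filtration_measurable hF.

Definition jump (m : nat) (x : T) (n : nat) : bool := 4 * phi m x < phi (m + n)%N x.

(** The delay is counted from [m]. It is never 0, since [phi] is nonnegative. *)
Definition first_jump (m : nat) (x : T) : option nat :=
  match pselect (exists n, jump m x n) with
  | left ex => Some (ex_minn ex)
  | right _ => None
  end.

Lemma first_jumpP m x n :
  first_jump m x = Some n <-> jump m x n /\ forall k, (k < n)%N -> ~~ jump m x k.
Proof.
rewrite /first_jump; case: pselect => [ex|nex]; last first.
  by split => // -[j _]; exfalso; apply: nex; exists n.
case: ex_minnP => n0 j0 min0; split.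
  by move=> [<-]; split => // k kn; apply: contraTN kn => /min0; rewrite -leqNgt.
move=> [j minn]; congr Some; apply/eqP; rewrite eqn_leq min0//= leqNgt.
by apply/negP => /minn; rewrite j0.
Qed.

Lemma first_jumpN m x n : first_jump m x = None -> phi (m + n)%N x <= 4 * phi m x.
Proof.
rewrite /first_jump; case: pselect => // nex _.
by rewrite leNgt; apply/negP => j; apply: nex; exists n.
Qed.

Lemma filtration_jump m n : F (m + n)%N [set x | jump m x n].
Proof.
rewrite /jump.
have -> : [set x | 4 * phi m x < phi (m + n)%N x] =
    [set x | phi m x < 4^-1 * phi (m + n)%N x].
  by apply/seteqP; split => x /= ; lra.
apply: sigma_lt => // B mB.
  by apply: (filtration_le hF _ (phi_filt m mB)); rewrite leq_addr.
have : measurable ( *%R (4^-1 : R) @^-1` B).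
  have mM : measurable_fun setT ( *%R (4^-1 : R)) by exact: mulrl_measurable.
  by rewrite -[X in measurable X]setTI; exact: mM.
exact: phi_filt.
Qed.

Lemma filtration_first_jump m n :
  F (m + n)%N [set x | first_jump m x = Some n].
Proof.
have -> : [set x | first_jump m x = Some n] = [set x | jump m x n] `&`
    \bigcap_k (if (k < n)%N then ~` [set x | jump m x k] else setT).
  apply/seteqP; split => x /=.
    move=> /first_jumpP[j minj]; split => // k _; case: ifPn => // kn /=.
    exact/negP/minj.
  move=> [j minj]; apply/first_jumpP; split => // k kn; apply/negP.
  by have := minj k I; rewrite kn.
apply: sigma_setI => //; first exact: filtration_jump.
apply: sigma_bigcap => // k; case: ifPn => [kn|_]; last exact: sigma_setT.
apply: sigma_setC => //; apply: (filtration_le hF _ (filtration_jump m k)); lia.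
Qed.

(** Being counted from [s], this is a time on the clock of the local space that starts at [s]. *)
Definition next_time s : rtime T :=
  fun x => if s x is Some m then first_jump m x else None.

Lemma next_time_stop X s : shifted_space P F X s -> is_stopping_time X (next_time s).
Proof.
move=> hX n; apply/(shifted_filt hX); split => [x []//|k].
have : F (k + n)%N (rtime_at s k `&` [set x | first_jump k x = Some n]).
  apply: sigma_setI => //; last exact: filtration_first_jump.
  by apply: (filtration_le hF _ (shifted_stop hX k)); rewrite leq_addr.
congr (F _ _); rewrite (shifted_dom hX); apply/seteqP; split => x.
  by move=> [sk] /= j; rewrite /next_time /rtime_at /= sk.
by move=> [[_ /=]]; rewrite /next_time /rtime_at /= => + sk; rewrite sk.
Qed.

(** Handles the indices up to the stopping time; the later ones are bounded when no further jump
    occurs. *)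
Definition controlled s := forall x m, s x = Some m ->
  forall n, (n <= m)%N -> phi n x <= 4 * phi m x.

(** Let the jump lead from [k] to [k + j]. For [n <= k] the old control, and for [k < n < k + j] the
    absence of a jump, give [phi n x <= 4 * phi k x < phi (k + j) x]. *)
Lemma controlled_next s : controlled s -> controlled (rtime_add s (next_time s)).
Proof.
move=> cs x m; rewrite /rtime_add /next_time; case E: (s x) => [k|]//.
case J: (first_jump k x) => [j|]//= [<-] n nkj.
have /first_jumpP[jj minj] := J.
have p0 := phi_ge0 (k + j) x.
have [nk|kn] := leqP n k.
  by have := cs _ _ E _ nk; move: jj; rewrite /jump; lra.
move: nkj; rewrite leq_eqVlt => /orP[/eqP ->|nkj]; first by lra.
have : ~~ jump k x (n - k) by apply: minj; lia.
rewrite /jump subnKC; last exact: ltnW.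
by rewrite -leNgt; move: jj; rewrite /jump; lra.
Qed.

(** * One step of the construction: lower bounds for the conditional expectations *)

Section one_step.
Context (X : fspace T R) (s t : rtime T).
Hypothesis hX : shifted_space P F X s.
Hypothesis ht : is_stopping_time X t.

(** [s'] is the current stopping time on the original clock, [E] and [E'] are the sets where it and
    its successor are finite, and [G] is the sigma-algebra of the step. *)
Let s' := rtime_add s t.
Let E := [set x | s' x <> None].
Let E' := [set x | rtime_add s' (next_time s') x <> None].
Let S := E `\` E'.
Let G := stopped_sigma X t.

Let s'_stop := rtime_add_stop hF hX ht.

Let mE : measurable E.
Proof. exact: (rtime_measurable hF). Qed.

Let E_dom : E `<=` fs_dom X.
Proof. by rewrite (shifted_dom hX) /E /s' /rtime_add => x /=; case: (s x). Qed.

Let at_E m : rtime_at s' m `<=` E.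
Proof. by rewrite /E rtime_atE; exact: bigcup_sup. Qed.

(** Where [s' = m], events of [F m] may serve as test sets for conditional expectations given
    [G]. *)
Let stopped_at m A : F m A -> A `<=` rtime_at s' m -> G A.
Proof.
move=> FA As; apply/(stopped_sigmaP hF _ hX ht); split.
- exact: mF FA.
- by move=> x /As/at_E/E_dom.
- move=> n; have [<-|mn] := eqVneq m n; first by rewrite setIidl.
  have -> : A `&` rtime_at (rtime_add s t) n = set0; last by case: (sF n).
  apply/seteqP; split => x // -[/As]; rewrite /s' /rtime_at /= => -> [] mn'.
  by rewrite mn' eqxx in mn.
Qed.

(** On [s' = m] the sigma-algebras [G] and [F m] have the same trace, so both sides have the
    integral of [h] over every slice. *)
Lemma condexp_ge_phi : {ae P, forall x m, s' x = Some m ->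
  phi m x <= condexp X G h x}.
Proof.
have [kG ik kE] := condexp_shifted hF hX ht h_ge0 ih.
rewrite -/G in kG ik kE.
set k := condexp X G h in kG ik kE *.
apply/ae_foralln => m; have mD := mF (s'_stop m).
have DX : rtime_at s' m `<=` fs_dom X by move=> x /at_E/E_dom.
have mX := shifted_dom_measurable hF hX.
apply: (@ae_le_integral_slices _ _ _ P (rtime_at s' m)) => //.
- exact: integrableS (iphi m).
- exact: integrableS ik.
move=> q A AE.
have FA : F m A.
  have /(stopped_sigmaP hF _ hX ht)[_ _ /(_ m) h1] := kG _ (measurable_itv `]-oo, q[).
  have h2 := phi_filt m (measurable_itv `]q, +oo[).
  have := sigma_setI (sF m) h1 h2; congr (F _ _); rewrite AE; apply/seteqP; split => x.
    by move=> [[[_ /=]]]; rewrite !in_itv/= andbT.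
  move=> [[sm /= qp] kq]; split; last by rewrite /= in_itv/= andbT.
  by split => //; split; [exact: DX|rewrite /= in_itv].
rewrite phiE// -kE//; by apply: (stopped_at FA); rewrite AE => x [[]].
Qed.

Let J m := \bigcup_n [set x | first_jump m x = Some n].

Let at_E' m B : B `<=` rtime_at s' m -> B `&` E' = B `&` J m.
Proof.
move=> Bs; apply/seteqP; split => x [Bx]; have sm := Bs x Bx.
  rewrite /E' /rtime_add /next_time /= sm; case Ej: (first_jump m x) => [n|]//= _.
  by split => //; exists n.
move=> [n _ /= jn]; split => //.
by rewrite /E' /rtime_add /next_time /= sm jn.
Qed.

Let mjump m n : measurable [set x | first_jump m x = Some n].
Proof. exact: mF (filtration_first_jump m n). Qed.

Let mh := measurable_int _ ih.

Let int_sub A B : measurable A -> measurable B -> A `<=` B ->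
  (\int[P]_(x in A) (h x)%:E <= \int[P]_(x in B) (h x)%:E)%E.
Proof.
move=> mA mB AB; apply: ge0_subset_integral => //.
- exact: (measurable_funS measurableT _ mh).
- by move=> x _; rewrite lee_fin.
Qed.

(** Passing from [phi m] to [h] makes bounds obtained at different levels [m] comparable. *)
Let int_ge m A (a : R) : F m A -> 0 <= a -> (forall x, A x -> a <= phi m x) ->
  (a%:E * P A <= \int[P]_(x in A) (h x)%:E)%E.
Proof.
move=> FA a0 h1; have mA := mF FA; rewrite -(phiE FA) -(integral_cst P mA).
apply: ge0_le_integral => //.
exact: (measurable_funS measurableT _ (measurable_int _ (iphi m))).
Qed.

Let int_le m A (a : R) : F m A -> (forall x, A x -> phi m x <= a) ->
  (\int[P]_(x in A) (h x)%:E <= a%:E * P A)%E.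
Proof.
move=> FA h1; have mA := mF FA; rewrite -(phiE FA) -(integral_cst P mA).
apply: ge0_le_integral => //; first by move=> x _; rewrite lee_fin.
exact: (measurable_funS measurableT _ (measurable_int _ (iphi m))).
Qed.

(** On the piece of [B] that jumps after [n] steps, [phi (m + n)] exceeds [4 * a]. Summing the lower
    bounds over [n] and using the upper bound [2 * a] at level [m] leaves a factor 2. *)
Let half_pos m B (a : R) : F m B -> B `<=` rtime_at s' m -> 0 < a ->
  (forall x, B x -> a <= phi m x <= 2 * a) -> (2%:E * P (B `&` E') <= P B)%E.
Proof.
move=> FB Bs a0 aB; have mB := mF FB; rewrite (at_E' Bs) /J setI_bigcupr.
have mBJ n : measurable (B `&` [set x | first_jump m x = Some n]) by exact: measurableI.
have tBJ : trivIset setT (fun n => B `&` [set x | first_jump m x = Some n]).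
  by move=> i j _ _ [x [[_ /= ->] [_ /= []]]].
have : ((4 * a)%:E * P (\bigcup_i (B `&` [set x | first_jump m x = Some i]))
    <= (2 * a)%:E * P B)%E.
  apply: (@le_trans _ _ (\int[P]_(x in B) (h x)%:E)%E); last first.
    by apply: int_le FB _ => x /aB/andP[].
  apply: (@le_trans _ _ (\int[P]_(x in \bigcup_i
      (B `&` [set x | first_jump m x = Some i])) (h x)%:E)%E); last first.
    by apply: int_sub => //; [exact: bigcup_measurable|move=> x [n _ []]].
  rewrite measure_semi_bigcup//; last exact: bigcup_measurable.
  rewrite ge0_integral_bigcup//=; last 2 first.
  - exact: (measurable_funS measurableT _ mh).
  - by move=> x _; rewrite lee_fin.
  rewrite -nneseriesZl//; apply: lee_nneseries => n.
  - by move=> _ _; rewrite mule_ge0// lee_fin mulr_ge0// ltW.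
  - move=> _; apply: (@int_ge (m + n)%N).
    + apply: sigma_setI => //; last exact: filtration_first_jump.
      by apply: (filtration_le hF _ FB); rewrite leq_addr.
    + by rewrite mulr_ge0// ltW.
    + move=> x [Bx /first_jumpP[+ _]]; rewrite /jump => jx.
      by have /andP[] := aB x Bx; lra.
have -> : ((4 * a)%:E = (2 * a)%:E * 2%:E)%E by rewrite -EFinM; congr EFin; lra.
by rewrite -muleA lee_pmul2l// lte_fin mulr_gt0.
Qed.

(** The case without a positive [a]: [h] has integral 0 over [B], whereas [phi (m + n)] is positive
    on the piece that jumps after [n] steps, so that piece is null. *)
Let half_zero m B : F m B -> B `<=` rtime_at s' m ->
  (forall x, B x -> phi m x = 0) -> P (B `&` E') = 0%E.
Proof.
move=> FB Bs B0; have mB := mF FB; rewrite (at_E' Bs) /J setI_bigcupr.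
have mBJ n : measurable (B `&` [set x | first_jump m x = Some n]) by exact: measurableI.
apply/negligibleP; first exact: bigcup_measurable.
apply: negligible_bigcup => n; apply/negligibleP => //.
have FBJ : F (m + n)%N (B `&` [set x | first_jump m x = Some n]).
  apply: sigma_setI => //; last exact: filtration_first_jump.
  by apply: (filtration_le hF _ FB); rewrite leq_addr.
apply: (@measure0_integral_le0 _ _ _ P _ (phi (m + n)%N)) => //.
- exact: (measurable_funS measurableT _ (measurable_int _ (iphi _))).
- move=> x [Bx /first_jumpP[+ _]]; rewrite /jump B0//; lra.
- rewrite phiE//; apply: (@le_trans _ _ (\int[P]_(x in B) (h x)%:E)%E).
    by apply: int_sub => // x [].
  have := int_le FB (a := 0); rewrite mul0e; apply => x Bx; rewrite B0//.
Qed.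

Let mE' : measurable E'.
Proof.
have mat m : measurable (rtime_at s' m) by exact: mF (s'_stop m).
have mJ m : measurable (J m) by apply: bigcup_measurable => n _; exact: mjump.
have -> : E' = \bigcup_m (rtime_at s' m `&` J m).
  under eq_bigcupr => m _ do rewrite -(at_E' (@subset_refl _ _)).
  rewrite -setI_bigcupl -rtime_atE; apply/esym/setIidr => x /=.
  by rewrite /E' /rtime_add /=; case: (s' x).
by apply: bigcup_measurable => m _; exact: measurableI.
Qed.

Let mS : measurable S.
Proof. exact: measurableD. Qed.

Let half_S B : measurable B -> B `<=` E -> (2%:E * P (B `&` E') <= P B)%E ->
  ((2^-1)%:E * P B <= P (B `&` S))%E.
Proof.
move=> mB BE hB.
have -> : B `&` S = B `\` (B `&` E').
  by rewrite setDIr setDv set0U /S setIDA (setIidl BE).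
have mBE' : measurable (B `&` E') by exact: measurableI.
have -> : P (B `\` (B `&` E')) = (P B - P (B `&` E'))%E.
  rewrite measureD//; first by rewrite setIA setIid.
  by rewrite ltey_eq fin_num_measure.
have : P (B `&` E') \is a fin_num by rewrite fin_num_measure//; exact: measurableI.
have : P B \is a fin_num by rewrite fin_num_measure.
move: hB; case: (P B) => // b; case: (P (B `&` E')) => // e + _ _.
rewrite -!EFinM -EFinB !lee_fin; lra.
Qed.

Let iS : P.-integrable setT (EFin \o (\1_S : T -> R)).
Proof. exact: integrable_indic. Qed.

Let g := condexp X G \1_S.

(** A slice [A] of [D] on which [g] is below 1/2 lies in [F m]; there [g] integrates to [P (A & S)],
    with [&] for intersection, and this is at least half of [P A]. *)
Let condexp_slice m D : F m D -> D `<=` rtime_at s' m ->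
  (forall B, F m B -> B `<=` D -> (2%:E * P (B `&` E') <= P B)%E) ->
  {ae P, forall x, D x -> 2^-1 <= g x}.
Proof.
move=> FD Ds hD.
have [gG ig gE] := condexp_shifted hF hX ht (fun x => ler0n R (x \in S)) iS.
rewrite -/G -/g in gG ig gE.
have mD := mF FD.
have DX : D `<=` fs_dom X by move=> x /Ds/at_E/E_dom.
have mX := shifted_dom_measurable hF hX.
apply: (@ae_le_integral_slices _ _ _ P D (cst 2^-1)) => //.
- exact: finite_measure_integrable_cst.
- exact: integrableS ig.
move=> q A AE.
(* One of the two functions is constant: either the slice is empty or its condition on that function
   is void. *)
have [q2|q2] := boolP (q < 2^-1); last first.
  have -> : A = set0; last by rewrite !integral_set0.
  by rewrite AE; apply/seteqP; split => x // [[_ /=]]; rewrite (negbTE q2).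
have FA : F m A.
  have /(stopped_sigmaP hF _ hX ht)[_ _ /(_ m) h1] := gG _ (measurable_itv `]-oo, q[).
  have := sigma_setI (sF m) h1 FD; congr (F _ _); rewrite AE; apply/seteqP; split => x.
    by move=> [[[_ /=]]]; rewrite in_itv/=.
  move=> [[Dx /= _] gq]; split => //; split; last exact: Ds.
  by split; [exact: DX|rewrite /= in_itv].
have AD : A `<=` D by rewrite AE => x [[]].
have As : A `<=` rtime_at s' m by move=> x /AD/Ds.
have mA := mF FA.
rewrite gE; last exact: stopped_at FA As.
rewrite [leLHS](integral_cst P mA (2^-1)%:E) integral_indic// setIC.
by apply: half_S => //; [move=> x /As/at_E|exact: hD].
Qed.

(** [E] is covered by countably many sets: for each [m], the part of [s' = m] where [phi m] vanishes
    and the parts where it lies in [[a, 2 * a]], [a > 0] rational. *)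
Lemma condexp_ge_half : {ae P, forall x, E x -> 2^-1 <= g x}.
Proof.
have F_itv m (i : interval R) : F m (rtime_at s' m `&` phi m @^-1` [set` i]).
  by apply: sigma_setI => //; exact: (phi_filt m (measurable_itv i)).
have zero : {ae P, forall x m, rtime_at s' m x -> phi m x = 0 -> 2^-1 <= g x}.
  apply/ae_foralln => m.
  (* The zero level is written as an interval so that [F_itv] applies to it. *)
  have : {ae P, forall x, (rtime_at s' m `&` phi m @^-1` `[0, 0]) x -> 2^-1 <= g x}.
    apply: condexp_slice (F_itv m _) _ _ => [x []//|B FB BD].
    rewrite (half_zero FB) ?mule0// => [x /BD[]//|x /BD[_ /=]].
    by rewrite in_itv/=; have := phi_ge0 m x; lra.
  by apply: filterS => x gx sm p0; apply: gx; split => //=; rewrite in_itv/= p0 lexx.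
have pos : {ae P, forall x m (a : rat), 0 < (ratr a : R) -> rtime_at s' m x ->
    ratr a <= phi m x <= 2 * ratr a -> 2^-1 <= g x}.
  apply/ae_foralln => m; apply: ae_forall_rat => a.
  have [a0|a0] := boolP (0 < (ratr a : R)); last first.
    by apply: aeW => x.
  have : {ae P, forall x, (rtime_at s' m `&` phi m @^-1` `[ratr a, 2 * ratr a]) x ->
      2^-1 <= g x}.
    apply: condexp_slice (F_itv m _) _ _ => [x []//|B FB BD].
    apply: half_pos FB _ a0 _ => [x /BD[]//|x /BD[_ /=]].
    by rewrite in_itv/=.
  by apply: filterS => x gx _ sm p0; apply: gx; split => //=; rewrite in_itv.
apply: filterS2 zero pos => x zero pos Ex.
have [m sm] : exists m, rtime_at s' m x.
  by move: Ex; rewrite /E rtime_atE => -[m _ sm]; exists m.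
have [p0|p0] := eqVneq (phi m x) 0; first exact: zero sm p0.
have pgt0 : 0 < phi m x by rewrite lt_neqAle eq_sym p0 phi_ge0.
(* A rational [a] in this gap satisfies [a < phi m x < 2 * a]. *)
have /rat_in_itvoo[a] : phi m x / 2 < phi m x by lra.
rewrite in_itv/= => /andP[a1 a2]; apply: (pos m a) => //; lra.
Qed.

(** Integrating [condexp_ge_half] over [E], which belongs to [G], gives [P S >= P E / 2]. *)
Lemma measure_next_le : (2%:E * P E' <= P E)%E.
Proof.
have [gG ig gE] := condexp_shifted hF hX ht (fun x => ler0n R (x \in S)) iS.
rewrite -/G -/g in gG ig gE.
have mX := shifted_dom_measurable hF hX.
have igE : P.-integrable E (EFin \o g) by exact: integrableS ig.
have E'E : E' `<=` E by rewrite /E' /rtime_add /E => x /=; case: (s' x).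
have : ((2^-1)%:E * P E <= P S)%E.
  have -> : P S = (\int[P]_(x in E) (\1_S x)%:E)%E.
    by rewrite integral_indic// setIidl// => x [].
  rewrite -gE; last first.
    apply/(stopped_sigmaP hF _ hX ht); split => // m.
    by rewrite (setIidr (@at_E m)); exact: s'_stop.
  have mg : measurable_fun E g by apply/measurable_EFinP; exact: measurable_int igE.
  (* This maximum equals [g] almost everywhere on [E] and is at least 1/2 at every point, as the
     monotonicity of the integral requires. *)
  have mmax : measurable_fun E (EFin \o (fun x => Num.max (2^-1) (g x))).
    by apply/measurable_EFinP; exact: measurable_maxr.
  have -> : (\int[P]_(x in E) (g x)%:E =
      \int[P]_(x in E) (Num.max (2^-1) (g x))%:E)%E.
    apply: ae_eq_integral => //.
    - exact/measurable_EFinP.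
    - apply: filterS condexp_ge_half => x gx Ex; rewrite max_r//; exact: gx.
  rewrite -(integral_cst P mE); apply: ge0_le_integral => //.
    by move=> x _; rewrite lee_fin invr_ge0.
  by move=> x Ex; rewrite lee_fin le_max lexx.
have -> : P S = (P E - P E')%E.
  rewrite measureD//; first by rewrite (setIidr E'E).
  by rewrite ltey_eq fin_num_measure.
have : P E \is a fin_num by rewrite fin_num_measure.
have : P E' \is a fin_num by rewrite fin_num_measure.
case: (P E) => // b; case: (P E') => // e _ _.
rewrite -!EFinM -EFinB !lee_fin; lra.
Qed.

End one_step.

(** * The sequence of principal times *)

(* The state is the pair (start time of the local space, tau_i). It is frozen
   once sigma_i is a.s. infinite, as the degenerate clauses of [local_space] and
   [locally_shifted] demand. *)
Definition principal_step (st : rtime T * rtime T) : rtime T * rtime T :=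
  let s' := rtime_add st.1 st.2 in
  if (0 < P [set x | s' x <> None])%E then (s', next_time s') else st.

Definition principal_state (i : nat) : rtime T * rtime T :=
  iter i principal_step (fun=> Some 0%N, fun=> Some 0%N).

Definition principal_tau (i : nat) : rtime T := (principal_state i).2.

(** This is sigma_i, on the original clock. *)
Definition principal_time (i : nat) : rtime T :=
  rtime_add (principal_state i).1 (principal_tau i).

Local Notation space := (iter_space P F principal_tau).

Lemma principal_stateS i :
  (0 < P [set x | principal_time i x <> None])%E /\
    principal_state i.+1 = (principal_time i, next_time (principal_time i)) \/
  P [set x | principal_time i x <> None] = 0%E /\
    principal_state i.+1 = principal_state i.
Proof.
rewrite /principal_state iterS -/(principal_state i) /principal_step.
rewrite -/(principal_tau i) -/(principal_time i); case: ifPn => E0; [left|right] => //.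
by split => //; apply/eqP; rewrite eq_le measure_ge0 andbT leNgt.
Qed.

Lemma principal_stateP i :
  [/\ shifted_space P F (space i) (principal_state i).1,
      is_stopping_time (space i) (principal_tau i)
    & controlled (principal_time i)].
Proof.
elim: i => [|i [hX ht ctrl]].
  have b0 := base_space_shifted hF; split => //.
    by move=> n; rewrite /= setTI; exact: (shifted_stop b0 n).
  by move=> x m [<-] n; rewrite leqn0 => /eqP ->; have := phi_ge0 0 x; lra.
have EE := finite_part_add (principal_tau i) hX; rewrite -/(principal_time i) in EE.
rewrite /principal_tau /principal_time /principal_tau.
case: (principal_stateS i) => -[PE ->] /=.
  have hX' : shifted_space P F (local_space (space i) (principal_tau i)) (principal_time i).
    by apply: local_space_shifted => //; rewrite EE.
  by split => //; [exact: next_time_stop|exact: controlled_next].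
have -> : local_space (space i) (principal_tau i) = space i.
  by rewrite /local_space (mes_gt0 _ hX) EE PE ltxx.
by [].
Qed.

Lemma principal_E i :
  sparse_E P F principal_tau i = [set x | principal_time i x <> None].
Proof.
have [hX _ _] := principal_stateP i.
exact: (finite_part_add (principal_tau i) hX).
Qed.

Lemma principal_E_measurable i : measurable (sparse_E P F principal_tau i).
Proof.
have [hX ht _] := principal_stateP i.
by rewrite principal_E; exact/(rtime_measurable hF)/(rtime_add_stop hF hX ht).
Qed.

Lemma principal_timeS i : (0 < P (sparse_E P F principal_tau i))%E ->
  principal_time i.+1 = rtime_add (principal_time i) (next_time (principal_time i)).
Proof.
rewrite principal_E; case: (principal_stateS i) => -[PE e]; last by rewrite PE ltxx.
by rewrite [LHS]/principal_time /principal_tau e.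
Qed.

Lemma principal_E0 i : (0 < P (sparse_E P F principal_tau i))%E = false ->
  P (sparse_E P F principal_tau i) = 0%E /\
  sparse_E P F principal_tau i.+1 = sparse_E P F principal_tau i.
Proof.
rewrite !principal_E; case: (principal_stateS i) => -[PE e]; first by rewrite PE.
by move=> _; split => //; rewrite /principal_time /principal_tau e.
Qed.

Lemma principal_sparse : conditionally_sparse P F principal_tau.
Proof.
split => //.
- move=> i; rewrite /locally_shifted; have [hX _ _] := principal_stateP i.
  rewrite (mes_gt0 _ hX); case: ifPn => PE.
    by have [_ + _] := principal_stateP i.+1.
  move=> x _; rewrite /principal_tau; move: PE.
  rewrite (finite_part_add _ hX) -/(principal_time i).
  by case: (principal_stateS i) => -[PE -> //]; rewrite PE.
(* The inverse of the lower bound 1/2 from [condexp_ge_half]. *)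
exists 2; first by rewrite ler1n.
move=> i; have [PE|/negbTE/principal_E0[PE0 _]] :=
    boolP (0 < P (sparse_E P F principal_tau i))%E; last first.
  have mE := principal_E_measurable i.
  exists (sparse_E P F principal_tau i); split => // x /= nx; apply: contrapT => nE.
  by apply: nx; rewrite indicE memNset// mulr0.
have [hX ht _] := principal_stateP i.
have := condexp_ge_half hX ht.
rewrite -/(principal_time i) -principal_timeS// -!principal_E -/(sparse_S P F _ i).
apply: filterS => x gx; rewrite indicE.
have [xE|xE] := boolP (x \in _); last by rewrite mulr0.
by rewrite mulr1 /sparse_condexp /=; have := gx (set_mem xE); lra.
Qed.

Lemma principal_E_measure i :
  ((2 ^+ i)%:E * P (sparse_E P F principal_tau i) <= 1)%E.
Proof.
elim: i => [|i IH].
  rewrite expr0 mul1e probability_le1// principal_E.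
  by rewrite [X in measurable X](_ : _ = setT)//; apply/seteqP; split.
apply: le_trans IH; rewrite exprSr EFinM -muleA lee_pmul2l//.
have [PE|/negbTE/principal_E0[PE0 ->]] :=
    boolP (0 < P (sparse_E P F principal_tau i))%E; last by rewrite PE0 mule0.
have [hX ht _] := principal_stateP i.
have := measure_next_le hX ht.
by rewrite -/(principal_time i) -principal_timeS// -!principal_E.
Qed.

(** E_0 is the whole space, so a point in no S_i lies in every E_i; the measure of E_i is at most
    [2 ^- i]. *)
Lemma principal_S_cover :
  {ae P, forall x, exists i, sparse_S P F principal_tau i x}.
Proof.
have mE := principal_E_measurable.
pose N := \bigcap_i sparse_E P F principal_tau i.
have mN : measurable N by exact: bigcapT_measurable.
have PN0 : P N = 0%E.
  have PNi i : ((2 ^+ i)%:E * P N <= 1)%E.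
    apply: le_trans (principal_E_measure i); rewrite lee_pmul2l//.
    by apply: le_measure; rewrite ?inE//; exact: bigcap_inf.
  have rE : P N = (fine (P N))%:E by rewrite fineK// fin_num_measure.
  have r_ge0 : 0 <= fine (P N) by exact: fine_ge0.
  set r := fine (P N) in rE r_ge0.
  rewrite rE; congr EFin; apply/eqP; rewrite eq_le r_ge0 andbT leNgt.
  (* Chosen so that [r^-1 < n < 2 ^+ n], which contradicts [2 ^+ n * r <= 1]. *)
  apply/negP => r0; pose n := Num.bound r^-1.
  have h1 : r^-1 < n%:R by rewrite archi_boundP// invr_ge0 ltW.
  have h2 : n%:R < 2 ^+ n :> R by rewrite -natrX ltr_nat ltn_expl.
  have := PNi n; rewrite rE -EFinM lee_fin leNgt => /negP; apply.
  by rewrite -ltr_pdivrMr// mul1r (lt_trans h1).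
exists N; split => // x /= nS i _; elim: i => [|i IH].
  by rewrite principal_E.
by apply: contrapT => nE; apply: nS; exists i.
Qed.

Lemma principal_S_control i x n : sparse_S P F principal_tau i x ->
  exists2 m, principal_time i x = Some m & phi n x <= 4 * phi m x.
Proof.
move=> [Ei nEi]; have [_ _ ctrl] := principal_stateP i.
have [PE|/negbTE/principal_E0[_ EE]] :=
    boolP (0 < P (sparse_E P F principal_tau i))%E; last by rewrite EE in nEi.
move: Ei nEi; rewrite !principal_E principal_timeS//=.
case e : (principal_time i x) => [m|]// _ njump; exists m => //.
have [nm|mn] := leqP n m; first exact: ctrl e _ nm.
rewrite -(subnKC (ltnW mn)); apply: first_jumpN.
move: njump; rewrite /rtime_add /next_time e; case: (first_jump m x) => //= k nk.
by exfalso; apply: nk.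
Qed.

Lemma principal_dominates : {ae P, forall x n,
  ((phi n x)%:E <= 4%:E * sparse_sum P F principal_tau h x)%E}.
Proof.
have H : {ae P, forall x i m, principal_time i x = Some m ->
    phi m x <= sparse_condexp P F principal_tau i h x}.
  apply/ae_foralln => i; have [hX ht _] := principal_stateP i.
  exact: (condexp_ge_phi hX ht).
apply: filterS2 principal_S_cover H => x [i Si] H n.
(* A chosen version may be negative at some points, but at the present [x], if in S_k, it dominates
   a value of [phi]. Hence the series is at least its [i]-th term. *)
have term_ge0 k : (0 <= (sparse_condexp P F principal_tau k h x *
    \1_(sparse_S P F principal_tau k) x)%:E)%E.
  rewrite lee_fin indicE; have [xS|_] := boolP (x \in _); last by rewrite mulr0.
  have [m em _] := principal_S_control 0 (set_mem xS).
  by rewrite mulr1 (le_trans _ (H k m em)).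
have [m em nm] := principal_S_control n Si.
apply: (@le_trans _ _ (4 * sparse_condexp P F principal_tau i h x)%:E).
  by rewrite lee_fin (le_trans nm)// ler_pM2l//; exact: H.
rewrite EFinM lee_pmul2l// /sparse_sum (nneseriesD1 (n := i))//.
rewrite indicE mem_set// mulr1; apply: leeDl.
by apply: nneseries_ge0.
Qed.

End principal_times.

(** * From the martingale of the absolute value to the maximal function *)

Section maximal_function.
Context (d : measure_display) (T : measurableType d) (R : realType).
Context (P : probability T R) (F : nat -> set (set T)).
Hypothesis hF : filtered_probability_space P F.

(** The chosen version and its negative have the integrals of [f] and [- f], both at most those of
    [|f|]; each is compared with [phi] on slices. *)
Lemma abs_condexp_le (f phi : T -> R) (n : nat) :
  P.-integrable setT (EFin \o f) -> (forall x, 0 <= phi x) ->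
  (forall B : set R, measurable B -> F n (phi @^-1` B)) ->
  P.-integrable setT (EFin \o phi) ->
  (forall A, F n A ->
    (\int[P]_(x in A) (phi x)%:E = \int[P]_(x in A) `|f x|%:E)%E) ->
  {ae P, forall x, `|condexp (base_space P F) (F n) f x| <= phi x}.
Proof.
move=> intf phi0 mphi iphi phiE; rewrite /condexp.
(* Were there no version, the default 0 would satisfy the bound. *)
case: xgetP => [g _ [gF ig gE]|_]; last by apply: aeW => x; rewrite normr0.
rewrite /= in gF ig gE.
have sub A (k : T -> R) : F n A -> P.-integrable setT (EFin \o k) ->
    P.-integrable A (EFin \o k).
  by move=> /(filtration_measurable hF) mA; exact: integrableS.
have iabs : P.-integrable setT (EFin \o (fun x => `|f x|)) by exact: integrable_norm.
have le_phi (k e : T -> R) : (forall B : set R, measurable B -> F n (k @^-1` B)) ->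
    P.-integrable setT (EFin \o k) -> P.-integrable setT (EFin \o e) ->
    (forall x, e x <= `|f x|) -> (forall A, F n A ->
      (\int[P]_(x in A) (k x)%:E = \int[P]_(x in A) (e x)%:E)%E) ->
    {ae P, forall x, k x <= phi x}.
  move=> mk ik ie e_le kE.
  have : {ae P, forall x, setT x -> k x <= phi x}.
    apply: ae_le_integral_slices => // q A AE.
    have FA : F n A.
      have := sigma_setI (fps_sigma hF n) (mk _ (measurable_itv `]q, +oo[))
        (mphi _ (measurable_itv `]-oo, q[)); congr (F _ _).
      by rewrite AE setTI; apply/seteqP; split => x /=; rewrite !in_itv/= andbT.
    rewrite phiE// kE//; apply: le_integral.
    - exact: (filtration_measurable hF FA).
    - exact: sub.
    - exact: sub.
    - by move=> x _; rewrite lee_fin.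
  by apply: filterS => x; apply.
have h1 : {ae P, forall x, g x <= phi x}.
  apply: (le_phi g f) => //.
  - by move=> B mB; have := gF B mB; rewrite setTI.
  - by move=> x; exact: ler_norm.
have h2 : {ae P, forall x, - g x <= phi x}.
  apply: (le_phi (fun x => - g x) (fun x => - f x)).
  - move=> B mB; have mN : measurable ((-%R : R -> R) @^-1` B).
      have mo : measurable_fun setT (-%R : R -> R) by exact: oppr_measurable.
      by rewrite -[X in measurable X]setTI; exact: mo.
    by have := gF _ mN; rewrite setTI.
  - exact: integrableN ig.
  - exact: integrableN intf.
  - by move=> x; rewrite -normrN; exact: ler_norm.
  - move=> A FA; have mA := filtration_measurable hF FA.
    have eN (k : T -> R) : P.-integrable setT (EFin \o k) ->
        (\int[P]_(x in A) (- k x)%:E = - \int[P]_(x in A) (k x)%:E)%E.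
      move=> ik; have := integralZl mA (sub _ _ FA ik) (-1).
      rewrite /= => e; under eq_integral => x _ do rewrite -mulN1r EFinM.
      by rewrite e mulN1e.
    by rewrite !eN// gE.
by apply: filterS2 h1 h2 => x g1 g2; rewrite ler_norml g1 andbT lerNl.
Qed.

End maximal_function.

Unset Implicit Arguments.

Theorem theorem1p9 (d : measure_display) (T : measurableType d) (R : realType)
    (P : probability T R) (F : nat -> set (set T))
    (hF : filtered_probability_space P F) :
  exists C : R, 0 < C /\
    forall f : T -> R, P.-integrable [set: T] (EFin \o f) ->
      exists Sop : (T -> R) -> T -> \bar R,
        simple_sparse_operator P F Sop /\
        {ae P, forall x,
          (doob_maximal P F f x <= C%:E * Sop (fun y => `|f y|%R) x)%E}.
Proof.
(* The constant is the jump factor, whatever [f] is. *)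
exists 4; split => // f intf.
have iabs : P.-integrable setT (EFin \o (fun x => `|f x|)) by exact: integrable_norm.
(* Everywhere nonnegative versions of the conditional expectations of [|f|], chosen for all [n] at
   once; through them the stopping times depend on [f]. *)
have [phi phiP] := choice (fun n => condexp_exists
  (eq_ind_r (fun G => G `<=` measurable) (fps_sub hF (n := n))
    (sigma_algebra_id (fps_sigma hF n)))
  (fun x => normr_ge0 (f x)) iabs (fps_sigma hF n)).
have phi0 n : forall x, 0 <= phi n x by case: (phiP n).
have mphi n : forall B : set R, measurable B -> F n (phi n @^-1` B) by case: (phiP n).
have iphi n : P.-integrable setT (EFin \o phi n) by case: (phiP n).
have phiE n : forall A, F n A ->
    (\int[P]_(x in A) (phi n x)%:E = \int[P]_(x in A) `|f x|%:E)%E.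
  by case: (phiP n).
pose tau := principal_tau P phi.
exists (sparse_sum P F tau); split.
  by exists tau; split => //; exact: (principal_sparse hF _ iabs).
have dom := principal_dominates hF (fun x => normr_ge0 (f x)) iabs phi0 mphi iphi phiE.
have le_phi : {ae P, forall x n, `|condexp (base_space P F) (F n) f x| <= phi n x}.
  apply/ae_foralln => n.
  exact: (abs_condexp_le hF intf (phi0 n) (mphi n) (iphi n) (phiE n)).
apply: filterS2 dom le_phi => x dom le_phi.
apply: ge_ereal_sup => _ [n _ <-].
by apply: le_trans (dom n); rewrite lee_fin.
Qed.
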